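(* Let $x_1,\dots,x_m\in\mathbb{R}^n$, let $P_1,\dots,P_m\in\mathbb{R}^{n\times n}$ be symmetric positive definite, and assume that the intersection $\mathscr{F}=\bigcap_{i=1}^m\{x\in\mathbb{R}^n:(x-x_i)^TP_i^{-1}(x-x_i)\le1\}$ is a nonempty bounded region. Let $f(P)=\log\det(P)$ or $f(P)=\operatorname{tr}(P)$. Compared with the covariance intersection (CI) algorithm, the decoupled SDP relaxation method can derive a tighter ellipsoid containing the intersection $\mathscr{F}$ of the ellipsoids (both methods are defined in the context and use the same $f$).
   Context: The ellipsoid with center $c$ and shape matrix $P$ is $\{x\in\mathbb{R}^n:(x-c)^TP^{-1}(x-c)\le1\}$; its size, by which tightness is compared, is $f(P)$. Decoupled SDP relaxation method: let $\lambda^*$ minimize $f\Big(\big(\sum_{i=1}^m\lambda_iP_i^{-1}\big)^{-1}\Big)$ over $\lambda_1,\dots,\lambda_m\ge0$ subject to $$\begin{bmatrix}1-\sum_{i=1}^m\lambda_i+\sum_{i=1}^m\lambda_ix_i^TP_i^{-1}x_i & \sum_{i=1}^m\lambda_ix_i^TP_i^{-1}\\ \sum_{i=1}^m\lambda_iP_i^{-1}x_i&\sum_{i=1}^m\lambda_iP_i^{-1}\end{bmatrix}\succeq 0.$$ Output: the ellipsoid with shape matrix $P_0=\big(\sum_{i=1}^m\lambda_i^*P_i^{-1}\big)^{-1}$ and center $P_0\sum_{i=1}^m\lambda_i^*P_i^{-1}x_i$. Covariance intersection (CI) algorithm: let $\mathscr{D}^+=\{t\in\mathbb{R}^m:t_i\ge0,\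 \sum_{i=1}^mt_i=1\}$ and for $t\in\mathscr{D}^+$ put $P_t=\big(\sum_{i=1}^mt_iP_i^{-1}\big)^{-1}$ and $x_t=P_t\sum_{i=1}^mt_iP_i^{-1}x_i$. Let $t^*$ minimize $f(P_t)$ over $t\in\mathscr{D}^+$. Output: the ellipsoid with shape matrix $P_{t^*}$ and center $x_{t^*}$. *)

(* Defs.v *)
From HB Require Import structures.
From mathcomp Require Import all_boot all_order all_algebra.
From mathcomp Require Import all_classical all_reals all_analysis.
Import Order.TTheory GRing.Theory Num.Theory.
Import numFieldNormedType.Exports.

Set Implicit Arguments.
Unset Strict Implicit.
Unset Printing Implicit Defensive.

Local Open Scope classical_set_scope.
Local Open Scope ring_scope.

Definition posdefmx (R : realType) (n : nat) (A : 'M[R]_n) : Prop :=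
  A^T = A /\ forall v : 'cV[R]_n, v != 0 -> 0 < (v^T *m A *m v) 0 0.

Definition psdmx (R : realType) (n : nat) (A : 'M[R]_n) : Prop :=
  A^T = A /\ forall v : 'cV[R]_n, 0 <= (v^T *m A *m v) 0 0.

Definition ellipsoid (R : realType) (n : nat) (c : 'cV[R]_n) (P : 'M[R]_n) :
    set 'cV[R]_n :=
  [set z | ((z - c)^T *m invmx P *m (z - c)) 0 0 <= 1].

Definition logdet (R : realType) (n : nat) (P : 'M[R]_n) : R := ln (\det P).

Definition minimizer (R : realType) (T : Type) (g : T -> R) (D : set T) (w : T) :
    Prop :=
  D w /\ forall u, D u -> g w <= g u.

Section Fusion.
Variables (R : realType) (n m : nat).
Variables (x : 'I_m -> 'cV[R]_n) (P : 'I_m -> 'M[R]_n).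
Implicit Type w : 'I_m -> R.

Definition ellipsoid_inter : set 'cV[R]_n :=
  \bigcap_(i in [set: 'I_m]) ellipsoid (x i) (P i).

Definition information w : 'M[R]_n := \sum_i w i *: invmx (P i).

Definition information_vector w : 'cV[R]_n :=
  \sum_i w i *: (invmx (P i) *m x i).

Definition fused_shape w : 'M[R]_n := invmx (information w).

Definition fused_center w : 'cV[R]_n := fused_shape w *m information_vector w.

Definition sdp_matrix w : 'M[R]_(1 + n) :=
  block_mx
    ((1 - \sum_i w i)%:M + \sum_i w i *: ((x i)^T *m invmx (P i) *m x i))
    (\sum_i w i *: ((x i)^T *m invmx (P i)))
    (information_vector w)
    (information w).

(* The objective involves the inverse of [information w], so the domain is
   restricted to weights for which that inverse exists. The restriction cannot
   be dropped: [invmx] is the identity on singular matrices, so [w = 0],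
   which satisfies the linear matrix inequality, would get the shape matrix 0
   and thereby the least trace. *)
Definition sdp_feasible : set ('I_m -> R) :=
  [set w | [/\ forall i, 0 <= w i,
               information w \in unitmx
             & psdmx (sdp_matrix w)]].

Definition sdp_solution (f : 'M[R]_n -> R) w : Prop :=
  minimizer (fun u => f (fused_shape u)) sdp_feasible w.

Definition ci_simplex : set ('I_m -> R) :=
  [set t | (forall i, 0 <= t i) /\ \sum_i t i = 1].

Definition ci_solution (f : 'M[R]_n -> R) w : Prop :=
  minimizer (fun u => f (fused_shape u)) ci_simplex w.

End Fusion.

(* Main.v *)
(* The quadratic form of the linear matrix inequality at [(a, v)] is
   [a^2 (1 - sum w) + sum w_i q_i (a x_i + v)], with [q_i] the form of
   [(P i)^-1]. On the simplex the first term vanishes, so every CI weight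
   vector is feasible for the SDP, which therefore has an optimum at most that of CI.
   At [(1, - c)], with [c] the fused center, the inequality bounds
   [sum w_i - sum w_i q_i (c - x_i)] by [1]; completing the square around [c]
   identifies [sum w_i q_i (z - x_i)] with the fused form at [z - c] plus
   [sum w_i q_i (c - x_i)], which gives the containment. *)
Require Import Defs.
From HB Require Import structures.
From mathcomp Require Import all_boot all_order all_algebra.
From mathcomp Require Import all_classical all_reals all_analysis.
From mathcomp Require Import ring lra.
Import Order.TTheory GRing.Theory Num.Theory.
Import numFieldNormedType.Exports.

Local Open Scope classical_set_scope.
Local Open Scope ring_scope.

Section QuadraticForm.
Set Implicit Arguments.
Unset Strict Implicit.
Variables (R : realType) (n : nat).
Implicit Types (A : 'M[R]_n) (u v : 'cV[R]_n).

Definition mxform A v : R := (v^T *m A *m v) 0 0.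

Lemma mxform0 A : mxform A 0 = 0.
Proof. by rewrite /mxform mulmx0 mxE. Qed.

Lemma mxformN A v : mxform A (- v) = mxform A v.
Proof. by rewrite /mxform [(- v)^T]linearN /= mulmxN !mulNmx opprK. Qed.

Lemma mxformD A u v : A^T = A ->
  mxform A (u + v) = mxform A u + (u^T *m A *m v) 0 0 *+ 2 + mxform A v.
Proof.
move=> symA.
have vAu : (v^T *m A *m u) 0 0 = (u^T *m A *m v) 0 0.
  (* A 1 x 1 matrix equals its transpose, and transposing swaps [u] and [v] since [A] is
     symmetric. *)
  rewrite -[in RHS](trmxK (u^T *m A *m v)) [in RHS]mxE.
  by rewrite !trmx_mul trmxK symA mulmxA.
rewrite /mxform [(_ + _)^T]linearD /= !mulmxDl !mulmxDr.
rewrite mxE [X in X + _]mxE [X in _ + X]mxE vAu.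
by ring.
Qed.

Lemma mxform_sum m (w : 'I_m -> R) (B : 'I_m -> 'M[R]_n) v :
  mxform (\sum_i w i *: B i) v = \sum_i w i * mxform (B i) v.
Proof.
rewrite /mxform mulmx_sumr mulmx_suml summxE.
by apply: eq_bigr => i _; rewrite -scalemxAr -scalemxAl mxE.
Qed.

Lemma posdefmx_form_gt0 A v : posdefmx A -> v != 0 -> 0 < mxform A v.
Proof. by case=> _; apply. Qed.

Lemma posdefmx_form_ge0 A v : posdefmx A -> 0 <= mxform A v.
Proof.
move=> pdA; have [->|v0] := eqVneq v 0; first by rewrite mxform0.
exact/ltW/posdefmx_form_gt0.
Qed.

(** A nonzero row vector killed by [A] would make the form vanish at its transpose. *)
Lemma posdefmx_unit A : posdefmx A -> A \in unitmx.
Proof.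
case=> _ posA; rewrite unitmxE unitfE; apply/det0P => -[v v0 vA0].
have := posA v^T; rewrite trmxK vA0 mul0mx mxE ltxx trmx_eq0 => /(_ v0).
by [].
Qed.

(** The form of [invmx A] at [v] is the form of [A] at [invmx A *m v], which is nonzero when [v]
    is. *)
Lemma posdefmx_inv A : posdefmx A -> posdefmx (invmx A).
Proof.
move=> pdA; have uA := posdefmx_unit pdA; have [symA posA] := pdA.
have symV : (invmx A)^T = invmx A by rewrite trmx_inv symA.
split=> // v v0.
have Av0 : invmx A *m v != 0.
  by apply: contra v0 => /eqP Av0; rewrite -(mulKVmx uA v) Av0 mulmx0.
have := posA _ Av0.
by rewrite trmx_mul symV -!mulmxA (mulKVmx uA).
Qed.

End QuadraticForm.

Section Fusion.
Set Implicit Arguments.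
Unset Strict Implicit.
Variables (R : realType) (n m : nat).
Variables (x : 'I_m -> 'cV[R]_n) (P : 'I_m -> 'M[R]_n).
Hypothesis posP : forall i, posdefmx (P i).
Implicit Type w : 'I_m -> R.

Lemma information_sym w : (information P w)^T = information P w.
Proof.
rewrite /information linear_sum; apply: eq_bigr => i _.
by rewrite linearZ /=; have [-> _] := posdefmx_inv (posP i).
Qed.

Lemma information_posdef w i0 :
  (forall i, 0 <= w i) -> w i0 != 0 -> posdefmx (information P w).
Proof.
move=> w0 wi0; split=> [|v v0]; first exact: information_sym.
rewrite -/(mxform _ v) mxform_sum (bigD1 i0) //=.
apply: ltr_pwDl.
  by rewrite mulr_gt0 ?posdefmx_form_gt0 ?lt0r ?wi0 ?w0 //; apply: posdefmx_inv.
by apply: sumr_ge0 => i _; rewrite mulr_ge0 // posdefmx_form_ge0 //;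
  apply: posdefmx_inv.
Qed.

(** Invertibility forces some weight to be nonzero: otherwise the matrix is zero and has rank 0
    instead of [n]. *)
Lemma information_unit_posdef w : (0 < n)%N ->
  (forall i, 0 <= w i) -> information P w \in unitmx ->
  posdefmx (information P w).
Proof.
move=> n0 w0 uw; have [/existsP[i wi]|] := boolP [exists i, w i != 0].
  exact: information_posdef wi.
rewrite negb_exists => /forallP wz; move: uw.
rewrite /information big1 => [|i _]; last first.
  by have /negPn/eqP-> := wz i; rewrite scale0r.
by move/mxrank_unit; rewrite mxrank0 => n_eq0; move: n0; rewrite -n_eq0.
Qed.

Lemma simplex_posdef w : ci_simplex w -> posdefmx (information P w).
Proof.
case=> w0 w1; have [/existsP[i wi]|] := boolP [exists i, w i != 0].
  exact: information_posdef wi.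
rewrite negb_exists => /forallP wz; have := oner_neq0 R.
by rewrite -w1 big1 ?eqxx // => i _; have /negPn/eqP := wz i.
Qed.

Lemma sdp_matrix_sym w : (sdp_matrix x P w)^T = sdp_matrix x P w.
Proof.
have symV i := (posdefmx_inv (posP i)).1.
rewrite /sdp_matrix tr_block_mx information_sym; congr block_mx.
- by apply/matrixP => i j; rewrite !ord1 mxE.
- rewrite /information_vector linear_sum; apply: eq_bigr => i _.
  by rewrite linearZ /= trmx_mul symV.
- rewrite /information_vector linear_sum; apply: eq_bigr => i _.
  by rewrite linearZ /= trmx_mul symV trmxK.
Qed.

(** Expanding each summand in powers of [a], the quadratic terms match the corner block, the linear
    ones the two off-diagonal blocks, and the constant ones the information block. *)
Lemma sdp_form w a v :
  mxform (sdp_matrix x P w) (col_mx a%:M v) =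
  a ^+ 2 * (1 - \sum_i w i) +
  \sum_i w i * mxform (invmx (P i)) (a *: x i + v).
Proof.
have symV i := (posdefmx_inv (posP i)).1.
have scaleE b (B : 'M[R]_1) : (b *: B) 0 0 = b * B 0 0 by rewrite mxE.
have formE i : mxform (invmx (P i)) (a *: x i + v) =
    a ^+ 2 * mxform (invmx (P i)) (x i) +
    2 * a * ((x i)^T *m invmx (P i) *m v) 0 0 + mxform (invmx (P i)) v.
  rewrite mxformD // [mxform _ (a *: _)]/mxform ![(a *: x i)^T]linearZ /=.
  by rewrite -!scalemxAl -scalemxAr !scaleE mulrA -expr2 -mulr_natl mulrA.
have cornerE : (\sum_i w i *: ((x i)^T *m invmx (P i) *m x i)) 0 0 =
    \sum_i w i * mxform (invmx (P i)) (x i).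
  by rewrite summxE; apply: eq_bigr => i _; rewrite mxE.
have rowE : ((\sum_i w i *: ((x i)^T *m invmx (P i))) *m v) 0 0 =
    \sum_i w i * ((x i)^T *m invmx (P i) *m v) 0 0.
  rewrite mulmx_suml summxE; apply: eq_bigr => i _.
  by rewrite -scalemxAl mxE.
have colE : (v^T *m information_vector x P w) 0 0 =
    \sum_i w i * ((x i)^T *m invmx (P i) *m v) 0 0.
  rewrite mulmx_sumr summxE; apply: eq_bigr => i _.
  rewrite -scalemxAr mxE -[in RHS](trmxK (_ *m v)) [in RHS]mxE.
  by rewrite !trmx_mul trmxK symV.
under [in X in _ = _ + X]eq_bigr => i _.
  rewrite formE !mulrDr mulrCA (mulrCA _ (2 * a)).
  over.
rewrite !big_split /= -!mulr_sumr -cornerE -[in RHS]rowE -mxform_sum.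
rewrite /sdp_matrix /mxform tr_col_mx tr_scalar_mx mul_row_block mul_row_col.
rewrite !mul_scalar_mx mul_mx_scalar mulmxDl -scalemxAl.
have addE (B C : 'M[R]_1) : (B + C) 0 0 = B 0 0 + C 0 0 by rewrite mxE.
rewrite -/(information P w) !(addE, scaleE) colE -rowE [_%:M 0 0]mxE eqxx.
by rewrite mulr1n; ring.
Qed.

Lemma simplex_feasible w : ci_simplex w -> sdp_feasible x P w.
Proof.
move=> sw; have [w0 w1] := sw; split=> //.
  exact/posdefmx_unit/simplex_posdef.
split=> [|v]; first exact: sdp_matrix_sym.
(* Every vector of size [1 + n] splits into a scalar and a vector of size [n], so [sdp_form] covers
   all cases. *)
rewrite -/(mxform _ v) -(vsubmxK v) (mx11_scalar (usubmx v)).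
rewrite sdp_form w1 subrr mulr0 add0r.
by apply: sumr_ge0 => i _; rewrite mulr_ge0 // posdefmx_form_ge0 //;
  apply: posdefmx_inv.
Qed.

Lemma fused_complete_square w z : information P w \in unitmx ->
  \sum_i w i * mxform (invmx (P i)) (z - x i) =
  mxform (information P w) (z - fused_center x P w) +
  \sum_i w i * mxform (invmx (P i)) (fused_center x P w - x i).
Proof.
move=> uw; set c := fused_center x P w.
(* The cross terms cancel because [c] solves [information P w *m c = information_vector x P w]. *)
have cross : \sum_i w i * ((z - c)^T *m invmx (P i) *m (c - x i)) 0 0 = 0.
  transitivity (((z - c)^T *m
      (information P w *m c - information_vector x P w)) 0 0).
    rewrite /information /information_vector mulmx_suml -sumrB mulmx_sumr summxE.
    apply: eq_bigr => i _.
    by rewrite -scalemxAl -scalerBr -mulmxBr -scalemxAr [RHS]mxE mulmxA.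
  by rewrite /c /fused_center /fused_shape mulKVmx // subrr mulmx0 mxE.
rewrite mxform_sum -big_split /=.
under eq_bigr => i _.
  (* Split [z - x i] as [(z - c) + (c - x i)]. *)
  rewrite -(subrKA c z) mxformD ?(posdefmx_inv (posP i)).1 //.
  rewrite mulrDr mulrDr mulrnAr addrAC.
  over.
by rewrite big_split /= sumrMnl cross mul0rn addr0.
Qed.

Lemma inter_sub_fused w : sdp_feasible x P w ->
  ellipsoid_inter x P `<=` ellipsoid (fused_center x P w) (fused_shape P w).
Proof.
case=> w0 uw [_ psdw] z Fz; rewrite /ellipsoid /= /fused_shape invmxK.
rewrite -/(mxform _ _).
have sumz : \sum_i w i * mxform (invmx (P i)) (z - x i) <= \sum_i w i.
  by apply: ler_sum => i _; rewrite ler_piMr //; apply: Fz.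
(* Among vectors with top entry 1, this one minimises the form of the matrix inequality, so it
   yields the sharpest bound. *)
have := psdw (col_mx 1%:M (- fused_center x P w)).
rewrite -/(mxform _ _) sdp_form expr1n mul1r.
under [in X in _ <= _ + X]eq_bigr => i _.
  rewrite scale1r -opprB mxformN.
  over.
move: sumz; rewrite (fused_complete_square _ uw).
(* With [S] the sum of the weights and [T] the weighted sum at the center, the fused form plus [T]
   is at most [S], and [S] is at most [1 + T]. *)
by lra.
Qed.

End Fusion.

Theorem corollary5p6 (R : realType) (n m : nat)
    (x : 'I_m -> 'cV[R]_n) (P : 'I_m -> 'M[R]_n) (f : 'M[R]_n -> R)
    (lambda t : 'I_m -> R) :
  (0 < n)%N ->
  (forall i, posdefmx (P i)) ->
  ellipsoid_inter x P !=set0 ->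
  bounded_set (ellipsoid_inter x P) ->
  f = @logdet R n \/ f = @mxtrace R n ->
  sdp_solution x P f lambda ->
  ci_solution P f t ->
  let P0 := fused_shape P lambda in
  let c0 := fused_center x P lambda in
  let Pt := fused_shape P t in
  let ct := fused_center x P t in
  [/\ posdefmx P0,
      ellipsoid_inter x P `<=` ellipsoid c0 P0,
      posdefmx Pt,
      ellipsoid_inter x P `<=` ellipsoid ct Pt
    & f P0 <= f Pt].
Proof.
move=> n0 posP _ _ _ [feas_lambda min_lambda] [simp_t _] P0 c0 Pt ct.
have feas_t := simplex_feasible x posP simp_t.
have [lambda0 unit_lambda _] := feas_lambda.
split.
- exact/posdefmx_inv/information_unit_posdef.
- exact: inter_sub_fused.
- exact/posdefmx_inv/simplex_posdef.
- exact: inter_sub_fused.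
(* The CI weights compete in the SDP by [feas_t], so the SDP minimum is no larger. *)
- exact: min_lambda.
Qed.
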